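(* For any fixed $k \in \mathbb{N}$, under the measures $\mathbb{P}_{n,k}$, $$\frac{I}{n^2} \longrightarrow a_k \quad \text{in probability, as } n \to \infty, \qquad\text{where } a_k = \frac{1}{2(k+1)}.$$
   Context: $\mathbb{N}=\{1,2,\dots\}$. For $k,n\in\mathbb{N}$, the $k$-card-minimum ($k$CM) procedure generates a random permutation of $\{1,\dots,n\}$ as follows. Let $D_1=\{1,\dots,n\}$. For $t=1,\dots,n$: given the past, $C_{t,1},\dots,C_{t,k}$ are i.i.d. uniform samples from $D_t$; $C_t=\min\{C_{t,1},\dots,C_{t,k}\}$; and $D_{t+1}=D_t\setminus\{C_t\}$. The resulting permutation is $\sigma=(C_1,\dots,C_n)$. $\mathbb{P}_{n,k}$ denotes the probability measure of this procedure with parameters $n,k$. $I=I(\sigma)=|\{i<j:\sigma(i)>\sigma(j)\}|$ is the number of inversions of $\sigma$. Convergence in probability means $\mathbb{P}_{n,k}(|I/n^2-a_k|>\epsilon)\to 0$ as $n \to \infty$ for every $\epsilon>0$. *)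

(* Defs.v *)
From HB Require Import structures.
From mathcomp Require Import all_boot all_order all_algebra all_fingroup.
From mathcomp Require Import all_classical all_reals all_analysis.

Set Implicit Arguments.
Unset Strict Implicit.
Unset Printing Implicit Defensive.

Import Order.TTheory GRing.Theory Num.Theory.
Import numFieldNormedType.Exports.

Local Open Scope ring_scope.

(* The cards 1, ..., n are the ordinals 0, ..., n-1 of 'I_n and the rounds
   t = 1, ..., n are likewise indexed from 0; only the order of the cards and
   of the rounds matters. *)

(* The k samples (C_{t,1}, ..., C_{t,k}) of one round. *)
Definition round (n k : nat) := {ffun 'I_k -> 'I_n}.

(* C_t = min_i C_{t,i}. The default value n exceeds every card, so for k > 0
   this is the minimum of the samples. *)
Definition card_min (n k : nat) (x : round n k) : nat :=
  \big[minn/n]_(i < k) (x i : nat).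

Definition unif (R : realType) (n : nat) (D : {set 'I_n}) (c : 'I_n) : R :=
  (c \in D)%:R / #|D|%:R.

(* The probability that the successive rounds are exactly those listed in w,
   when the deck of remaining cards is D: given the past, the samples of a
   round are i.i.d. uniform on D, then their minimum is removed from D. *)
Fixpoint rounds_prob (R : realType) (n k : nat) (D : {set 'I_n})
    (w : seq (round n k)) : R :=
  if w is x :: w' then
    (\prod_(i < k) unif R D (x i)) *
    rounds_prob R [set c in D | (c : nat) != card_min x]%SET w'
  else 1.

(* P_{n,k}({s}): the total probability of the n-round outcomes for which
   (C_1, ..., C_n) = s, starting from the full deck D_1. *)
Definition kCM_mass (R : realType) (n k : nat) (s : {perm 'I_n}) : R :=
  \sum_(w : n.-tuple (round n k) |
          [forall t, card_min (tnth w t) == s t :> nat])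
    rounds_prob R [set: 'I_n]%SET w.

Definition kCM_prob (R : realType) (n k : nat) (A : pred {perm 'I_n}) : R :=
  \sum_(s : {perm 'I_n} | A s) kCM_mass R k s.

Definition inversions (n : nat) (s : {perm 'I_n}) : nat :=
  #|[pred p : 'I_n * 'I_n | (p.1 < p.2)%N && (s p.2 < s p.1)%N]|.

(* Main.v *)
Require Import Defs.
From HB Require Import structures.
From mathcomp Require Import all_boot all_order all_algebra all_fingroup.
From mathcomp Require Import all_classical all_reals all_analysis.
From mathcomp Require Import ring lra.

Set Implicit Arguments.
Unset Strict Implicit.
Unset Printing Implicit Defensive.

Import Order.TTheory GRing.Theory Num.Theory.
Import numFieldNormedType.Exports.

Local Open Scope classical_set_scope.
Local Open Scope ring_scope.

(** An inversion is a pair (removed card, smaller card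
    still in the deck), so the number of inversions is the sum over the rounds
    of the rank of the removed card: the number of smaller cards in the current
    deck ([inversions_total_rank]).

    Given the past, a round on a deck of m cards produces a rank whose law
    depends on m alone, since it is at least j exactly when the ranks of all k
    samples are. Its mean is the sum of (j / m) ^ k over j < m ([mean_rank_round]), which
    lies within 1 of m / (k + 1) ([mean_rank_bounds]), and it deviates from
    this mean by at most m.  Summed over m <= n the means give n^2 / (2 (k + 1))
    up to an error n ([mean_total_asymptotics]).

    As the conditional mean of each rank is deterministic, the centered ranks
    are orthogonal, and the variance of their sum is at most the sum of m^2
    over m <= n, hence at most n^3 ([variance_total_rank]).  This is o(n^4),
    so Chebyshev's inequality bounds the probability of a deviation eps of
    I / n^2 by 2 / (eps^2 n) ([kCM_prob_deviation]).

    The moments are computed on sequences of rounds, by induction on their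
    length for an arbitrary starting deck of that many cards; the
    permutation is involved only in [inversions_total_rank] and in the transfer
    inequality [kCM_prob_le]. *)

(** * Inversions as a sum of ranks *)

Definition rank (n : nat) (D : {set 'I_n}) (v : nat) : nat :=
  #|[set c in D | (c < v)%N]%SET|.

Definition discard (n : nat) (D : {set 'I_n}) (v : nat) : {set 'I_n} :=
  [set c in D | (c : nat) != v]%SET.

Fixpoint total_rank (n k : nat) (D : {set 'I_n}) (w : seq (round n k)) : nat :=
  if w is x :: w' then
    (rank D (card_min x) + total_rank (discard D (card_min x)) w')%N
  else 0%N.

Definition round_prob (R : realType) (n k : nat) (D : {set 'I_n})
    (x : round n k) : R := \prod_(i < k) unif R D (x i).

(** The mean of the rank of the card removed from a deck of [m] cards; see
    [mean_rank_round]. *)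
Definition mean_rank (R : realType) (k m : nat) : R :=
  \sum_(j < m) (j%:R / m%:R) ^+ k.

Definition mean_total (R : realType) (k n : nat) : R :=
  \sum_(m < n) mean_rank R k m.+1.

(** Unfolds the successive decks: what is left of [D] before round [t] is [D]
    without the first [t] minima. The default [x0] is never read. *)
Lemma total_rankE (n k : nat) (D : {set 'I_n}) (w : seq (round n k))
    (x0 : round n k) :
  total_rank D w =
  (\sum_(t < size w)
    #|[set c in D | (c < card_min (nth x0 w t))%N &
        (c : nat) \notin take t [seq card_min x | x <- w]]%SET|)%N.
Proof.
elim: w D => [|x w IH] D /=; first by rewrite big_ord0.
rewrite big_ord_recl /= IH; congr (_ + _)%N.
  by rewrite /rank; apply: eq_card => c; rewrite !inE andbT.
apply: eq_bigr => t _; apply: eq_card => c.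
by rewrite !inE negb_or; do !case: (_ \in _) => //=; do !case: (_ == _) => //=;
  rewrite ?andbF ?andbT.
Qed.

(** Starting from the full deck, the cards left before round [t] are the [s j]
    with [t <= j], so those below [s t] are in bijection, through [s], with the
    inversions whose first position is [t]. *)
Lemma inversions_total_rank (n k : nat) (s : {perm 'I_n})
    (w : n.-tuple (round n k)) :
  (forall t, card_min (tnth w t) = s t :> nat) ->
  inversions s = total_rank [set: 'I_n]%SET w.
Proof.
move=> ws; case: n s w ws => [|n] s w ws.
  (* without cards there is no round to serve as a default for nth *)
  by rewrite tuple0 /=; apply: eq_card0 => -[[]].
rewrite (total_rankE _ _ (thead w)) size_tuple.
have -> : [seq card_min x | x <- w] = [seq (s t : nat) | t <- enum 'I_n.+1].
  apply: (@eq_from_nth _ 0%N).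
    by rewrite size_map size_tuple size_map -cardE card_ord.
  move=> i; rewrite size_map size_tuple => ltin.
  rewrite (nth_map (thead w)) ?size_tuple // (nth_map ord0) -?cardE ?card_ord //.
  by rewrite -[i]/(nat_of_ord (Ordinal ltin)) -tnth_nth ws nth_ord_enum.
rewrite /inversions -sum1_card.
rewrite (eq_bigl (fun p : 'I_n.+1 * 'I_n.+1 =>
   xpredT p.1 && ((p.1 < p.2)%N && (s p.2 < s p.1)%N))) //.
rewrite -(pair_big_dep xpredT (fun i j : 'I_n.+1 => (i < j)%N && (s j < s i)%N)
   (fun _ _ => 1%N)) /=.
apply: eq_bigr => t _; rewrite sum1_card.
rewrite -(card_imset _ (@perm_inj _ s)); apply: eq_card => c.
rewrite !inE -tnth_nth ws.
have [j ->] : exists j, c = s j by exists (s^-1 c)%g; rewrite permKV.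
rewrite (mem_imset _ _ (@perm_inj _ s)) unfold_in /=.
rewrite -map_take (mem_map (f := fun t : 'I_n.+1 => (s t : nat))); last first.
  by move=> a b /= /ord_inj /perm_inj.
have -> : (j \in take t (enum 'I_n.+1)) = (j < t)%N.
  rewrite -(mem_map val_inj) map_take val_enum_ord take_iota mem_iota /= add0n.
  by rewrite (minn_idPl (ltnW (ltn_ord t))).
rewrite -leqNgt [(t <= j)%N]leq_eqVlt [RHS]andbC.
by case: (altP (t =P j :> nat)) => [/ord_inj <-|]; rewrite ?ltnn ?andbF ?andbT.
Qed.

(** * The minimum of the samples of a round *)

Lemma sum_tupleS (V : nmodType) (T : finType) (m : nat)
    (F : seq T -> V) :
  \sum_(w : m.+1.-tuple T) F w = \sum_x \sum_(w : m.-tuple T) F (x :: w).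
Proof.
rewrite pair_bigA /=.
rewrite (reindex (fun p : T * m.-tuple T => cons_tuple p.1 p.2)) //=.
exists (fun w : m.+1.-tuple T => (thead w, behead_tuple w)) => w _.
  by case: w => x w /=; congr pair; apply: val_inj.
by rewrite [RHS]tuple_eta; apply: val_inj.
Qed.

Lemma card_min_le (n k : nat) (x : round n k) (i : 'I_k) :
  (card_min x <= x i)%N.
Proof.
rewrite /card_min; have: i \in index_enum 'I_k by rewrite mem_index_enum.
elim: (index_enum _) => // j r IH; rewrite inE big_cons geq_min.
by case/orP => [/eqP<-|/IH->]; rewrite ?leqnn ?orbT.
Qed.

Lemma ltn_card_min (n k : nat) (x : round n k) (d : 'I_n) :
  (d < card_min x)%N = [forall i, (d < x i)%N].
Proof.
apply/idP/forallP => [dx i|dx]; first exact: leq_trans dx (card_min_le x i).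
rewrite /card_min.
by elim/big_ind: _ => [|a b da db|i _]; rewrite ?leq_min ?da ?db ?dx ?ltn_ord.
Qed.

Lemma card_min_attained (n k : nat) (x : round n k) :
  (0 < k)%N -> exists i, card_min x = x i :> nat.
Proof.
move=> k0; case: k k0 x => // k _ x.
have [i _ xi] :=
  arg_minnP (fun i => x i : nat) (erefl (xpredT (ord0 : 'I_k.+1))).
exists i; apply/eqP; rewrite eqn_leq card_min_le /=.
rewrite /card_min; elim/big_ind: _ => [|a b|j _]; first exact: ltnW.
  by rewrite leq_min => -> ->.
exact: xi.
Qed.

(** The counts of cards above [d], for [d] in [D], are 0, ..., #|D| - 1 in some
    order: removing the least card removes the value #|D| - 1 and leaves the
    other counts unchanged. *)
Lemma sum_cards_above (V : nmodType) (n : nat) (D : {set 'I_n}) (F : nat -> V) :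
  \sum_(d in D) F #|[set c in D | (d < c)%N]%SET| = \sum_(j < #|D|) F j.
Proof.
move: {2}#|D| (erefl #|D|) => m; elim: m D => [|m IH] D Dm.
  by rewrite (cards0_eq Dm) big_set0 cards0 big_ord0.
have [d0 d0D] : exists d0, d0 \in D by apply/set0Pn; rewrite -card_gt0 Dm.
have [d /= dD dmin] := @arg_minnP _ d0 (mem D) (fun i : 'I_n => i : nat) d0D.
have {}dD : d \in D by [].
have {}dmin j : j \in D -> (d <= j)%N by apply: dmin.
have Dm' : #|D :\ d| = m by move: Dm; rewrite (cardsD1 d) dD => -[].
rewrite Dm big_ord_recr /= (big_setD1 d) //= addrC; congr (_ + F _); last first.
  rewrite -Dm'; apply: eq_card => c; rewrite !inE andbC.
  case cD: (c \in D); rewrite ?andbF // !andbT.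
  by rewrite ltn_neqAle dmin // andbT eq_sym.
rewrite -[in RHS]Dm' -IH //; apply: eq_bigr => c; rewrite !inE => /andP[cd cD].
congr F; apply: eq_card => e; rewrite !inE.
case: (eqVneq e d) => //= ->; rewrite dD /=.
by rewrite ltnNge dmin.
Qed.

Lemma card_discard (n : nat) (D : {set 'I_n}) (d : 'I_n) (m : nat) :
  d \in D -> #|D| = m.+1 -> #|discard D d| = m.
Proof.
move=> dD Dm; have -> : discard D d = D :\ d.
  by apply/setP => c; rewrite !inE andbC.
by move: Dm; rewrite (cardsD1 d) dD => -[].
Qed.

(** * The law of the rank in one round *)

Section Rounds.
Variables (R : realType) (n k : nat).
Implicit Types (D : {set 'I_n}) (x : round n k).

Lemma round_prob_ge0 D x : 0 <= round_prob R D x.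
Proof. by apply: prodr_ge0 => i _; rewrite mulr_ge0 // invr_ge0. Qed.

Lemma round_prob_support D x :
  round_prob R D x != 0 -> forall i, x i \in D.
Proof.
move=> px i; apply: contraNT px => xi.
by rewrite /round_prob (bigD1 i) //= /unif (negbTE xi) !mul0r.
Qed.

Lemma sum_unif D (P : pred 'I_n) :
  \sum_c unif R D c * (P c)%:R = #|[set c in D | P c]%SET|%:R / #|D|%:R.
Proof.
rewrite -sum1_card natr_sum mulr_suml [RHS]big_mkcond /=; apply: eq_bigr => c _.
rewrite !inE /unif; case: (c \in D); case: (P c);
  by rewrite /= ?mul0r ?mulr0 ?mulr1 ?mul1r.
Qed.

(** Independence of the samples: a sum over families of a product of functions
    of one sample each is a product of sums. *)
Lemma round_prob_forall D (P : pred 'I_n) :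
  \sum_(x : round n k) round_prob R D x * [forall i, P (x i)]%:R
  = (#|[set c in D | P c]%SET|%:R / #|D|%:R) ^+ k.
Proof.
rewrite -sum_unif -[in RHS](card_ord k) -prodr_const.
rewrite (bigA_distr_bigA (fun _ : 'I_k => fun c => unif R D c * (P c)%:R)) /=.
apply: eq_bigr => x _; rewrite big_split /=; congr (_ * _).
case: forallP => [Px|/forallP].
  by rewrite big1 // => i _; rewrite Px.
by rewrite negb_forall => /existsP[i /negbTE Pi];
  rewrite (bigD1 i) //= Pi mul0r.
Qed.

Lemma sum_round_prob D : (0 < #|D|)%N ->
  \sum_(x : round n k) round_prob R D x = 1.
Proof.
move=> D0.
transitivity (\sum_(x : round n k)
  round_prob R D x * [forall i, predT (x i)]%:R).
  apply: eq_bigr => x _.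
  by rewrite (_ : [forall i, _] = true) ?mulr1 //; apply/forallP.
rewrite round_prob_forall (_ : [set c in D | _]%SET = D).
  by rewrite divff ?expr1n // pnatr_eq0 -lt0n.
by apply/setP => c; rewrite !inE andbT.
Qed.

(** The rank counts the cards [d] with all samples above [d]; such a [d] has
    probability (j / m) ^ k, where j is the number of cards above it, and j takes
    every value below m once. *)
Lemma mean_rank_round D :
  \sum_(x : round n k) round_prob R D x * (rank D (card_min x))%:R
  = mean_rank R k #|D|.
Proof.
transitivity (\sum_(d in D) \sum_(x : round n k)
  round_prob R D x * [forall i, (d < x i)%N]%:R).
  rewrite exchange_big; apply: eq_bigr => x _; rewrite -mulr_sumr; congr (_ * _).
  rewrite /rank -sum1_card natr_sum big_mkcond [RHS]big_mkcond.
  apply: eq_bigr => d _; rewrite !inE ltn_card_min.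
  by case: (d \in D) => //; case: [forall i, _].
rewrite /mean_rank -(sum_cards_above D (fun j => (j%:R / #|D|%:R) ^+ k)).
by apply: eq_bigr => d _; rewrite (round_prob_forall D (fun c => (d < c)%N)).
Qed.

Lemma mean_rank_ge0 m : 0 <= mean_rank R k m.
Proof. by apply: sumr_ge0 => j _; rewrite exprn_ge0 // divr_ge0. Qed.

Lemma mean_rank_le m : mean_rank R k m <= m%:R.
Proof.
rewrite -[leRHS]mulr1 mulrC mulr_natr -[in leRHS](card_ord m) -sumr_const.
apply: ler_sum => -[j jm] _ /=; apply: exprn_ile1; first by rewrite divr_ge0.
by rewrite ler_pdivrMr ?ltr0n ?(leq_ltn_trans _ jm) // mul1r ler_nat ltnW.
Qed.

(** The rank and its mean both lie between 0 and the size of the deck. *)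
Lemma sqr_rank_mean_rank D x :
  ((rank D (card_min x))%:R - mean_rank R k #|D|) ^+ 2 <= #|D|%:R ^+ 2.
Proof.
have rD : (rank D (card_min x))%:R <= #|D|%:R :> R.
  rewrite ler_nat subset_leq_card //; apply/fintype.subsetP => c.
  by rewrite inE => /andP[].
have r0 : 0 <= (rank D (card_min x))%:R :> R by [].
have mD := mean_rank_le #|D|; have m0 := mean_rank_ge0 #|D|.
by nra.
Qed.

(** * Moments of the total rank *)

Lemma rounds_prob_ge0 D (w : seq (round n k)) : 0 <= rounds_prob R D w.
Proof.
elim: w D => //= x w IH D; apply: mulr_ge0 => //; exact: round_prob_ge0.
Qed.

(** Conditioning on the first round: the outer sum is its expectation, the inner
    sum the expectation over the remaining rounds from the smaller deck. *)
Lemma sum_rounds_probS D (m : nat) (F : seq (round n k) -> R) :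
  \sum_(w : m.+1.-tuple (round n k)) rounds_prob R D w * F w =
  \sum_x round_prob R D x *
    \sum_(w : m.-tuple (round n k))
       rounds_prob R (discard D (card_min x)) w * F (x :: w).
Proof.
rewrite (sum_tupleS m (fun w => rounds_prob R D w * F w)).
apply: eq_bigr => x _; rewrite mulr_sumr; apply: eq_bigr => w _.
by rewrite mulrA.
Qed.

(** With at least one sample the minimum is a card of the deck, so a round of
    positive probability really removes a card. *)
Lemma card_discard_round D x (m : nat) :
  (0 < k)%N -> #|D| = m.+1 -> round_prob R D x != 0 ->
  #|discard D (card_min x)| = m.
Proof.
move=> k0 Dm /round_prob_support xD; have [i ->] := card_min_attained x k0.
exact: card_discard.
Qed.

Lemma sum_rounds_prob D (m : nat) : (0 < k)%N -> #|D| = m ->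
  \sum_(w : m.-tuple (round n k)) rounds_prob R D w = 1.
Proof.
move=> k0; elim: m D => [|m IH] D Dm.
  by rewrite (big_pred1 [tuple]) // => w; apply/esym/eqP/tuple0.
under eq_bigr do rewrite -[rounds_prob _ _ _]mulr1.
rewrite (sum_rounds_probS D m (fun=> 1)).
rewrite -[RHS](sum_round_prob (D := D)) ?Dm //; apply: eq_bigr => x _.
have [->|px] := eqVneq (round_prob R D x) 0; first by rewrite mul0r.
by rewrite -mulr_suml (IH _ (card_discard_round k0 Dm px)) !mulr1.
Qed.

Lemma mean_totalS m :
  mean_total R k m.+1 = mean_rank R k m.+1 + mean_total R k m.
Proof. by rewrite /mean_total big_ord_recr addrC. Qed.

(** The mean is the same for all decks of [m] cards, which makes the conditional
    mean of the later ranks independent of the first round. *)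
Lemma mean_total_rank D (m : nat) : (0 < k)%N -> #|D| = m ->
  \sum_(w : m.-tuple (round n k))
     rounds_prob R D w * ((total_rank D w)%:R - mean_total R k m) = 0.
Proof.
move=> k0; elim: m D => [|m IH] D Dm.
  rewrite big1 // => w _; rewrite tuple0 /= /mean_total big_ord0.
  by rewrite subrr mulr0.
rewrite (sum_rounds_probS D m
  (fun w => (total_rank D w)%:R - mean_total R k m.+1)).
transitivity (\sum_(x : round n k) round_prob R D x *
   ((rank D (card_min x))%:R - mean_rank R k m.+1)).
  apply: eq_bigr => x _.
  have [->|px] := eqVneq (round_prob R D x) 0; first by rewrite !mul0r.
  have Dx := card_discard_round k0 Dm px.
  congr (_ * _); rewrite -[RHS]addr0 -[X in _ + X](IH _ Dx).
  rewrite -[X in X + _]mulr1 -[X in _ * X + _](sum_rounds_prob k0 Dx).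
  rewrite mulr_sumr -big_split /=; apply: eq_bigr => w _.
  rewrite natrD mean_totalS; ring.
under eq_bigr do rewrite mulrBr.
rewrite sumrB mean_rank_round -mulr_suml sum_round_prob ?Dm //.
by rewrite mul1r subrr.
Qed.

(** In the square of (first rank - its mean) + (later ranks - their mean) the
    cross term vanishes, since the second bracket has conditional mean 0; the
    first square is at most (m + 1)^2 and (m + 1)^2 + m^3 <= (m + 1)^3. *)
Lemma variance_total_rank D (m : nat) : (0 < k)%N -> #|D| = m ->
  \sum_(w : m.-tuple (round n k))
     rounds_prob R D w * ((total_rank D w)%:R - mean_total R k m) ^+ 2
  <= m%:R ^+ 3.
Proof.
move=> k0; elim: m D => [|m IH] D Dm.
  rewrite big1 ?expr0n // => w _; rewrite tuple0 /= /mean_total big_ord0.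
  by rewrite subrr expr0n mulr0.
rewrite (sum_rounds_probS D m
  (fun w => ((total_rank D w)%:R - mean_total R k m.+1) ^+ 2)).
apply: (@le_trans _ _ (\sum_(x : round n k) round_prob R D x *
   (m.+1%:R ^+ 2 + m%:R ^+ 3))).
  apply: ler_sum => x _.
  have [->|px] := eqVneq (round_prob R D x) 0; first by rewrite !mul0r.
  have Dx := card_discard_round k0 Dm px.
  apply: ler_wpM2l; first exact: round_prob_ge0.
  have := sqr_rank_mean_rank D x; rewrite Dm.
  set d := _ - _ => dm.
  apply: le_trans (lerD dm (IH _ Dx)).
  rewrite -[X in X + _]mulr1 -[X in _ * X + _](sum_rounds_prob k0 Dx).
  (* insert the vanishing cross term, then compare the summands *)
  rewrite -[leRHS]addr0 -[X in _ <= _ + X](mulr0 (d *+ 2)).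
  rewrite -[X in _ <= _ + _ * X](mean_total_rank k0 Dx).
  rewrite !mulr_sumr -!big_split /= le_eqVlt; apply/orP; left; apply/eqP.
  apply: eq_bigr => w _; rewrite natrD mean_totalS /d; ring.
rewrite -mulr_suml sum_round_prob ?Dm // mul1r.
rewrite -natr1; have : 0 <= m%:R :> R by []; nra.
Qed.
End Rounds.

(** * Asymptotics of the mean *)

(** Each of the [k + 1] terms of the factorization of the difference of powers
    lies between [x ^+ k] and [(x + 1) ^+ k]. *)
Lemma exprS_increment (R : realType) (k : nat) (x : R) : 0 <= x ->
  (k.+1)%:R * x ^+ k <= (x + 1) ^+ k.+1 - x ^+ k.+1 <= (k.+1)%:R * (x + 1) ^+ k.
Proof.
move=> x0; rewrite subrXX (addrC x) addrK mul1r.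
have x1 : x <= 1 + x by rewrite lerDr.
have x10 : 0 <= 1 + x := le_trans x0 x1.
have cst (y : R) : k.+1%:R * y = \sum_(i < k.+1) y.
  by rewrite sumr_const card_ord mulr_natl.
rewrite !cst; apply/andP; split; apply: ler_sum => -[i ik] _ /=.
  rewrite -[in leLHS](subnK (ltnSE ik)) exprD.
  by rewrite ler_wpM2r ?exprn_ge0 // lerXn2r.
rewrite -[in leRHS](subnK (ltnSE ik)) exprD.
by rewrite ler_wpM2l ?exprn_ge0 // lerXn2r.
Qed.

(** The two Riemann sums that enclose the integral of x^k over [0, m], obtained
    by telescoping [exprS_increment]. *)
Lemma sum_powers (R : realType) (k m : nat) :
  (k.+1)%:R * \sum_(j < m) j%:R ^+ k <= m%:R ^+ k.+1 :> R /\
  m%:R ^+ k.+1 <= (k.+1)%:R * (\sum_(j < m) j%:R ^+ k + m%:R ^+ k) :> R.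
Proof.
elim: m => [|m [IH1 IH2]].
  rewrite big_ord0 mulr0 add0r expr0n /=; split => //.
  by rewrite mulr_ge0 ?exprn_ge0.
have /andP[H1 H2] := @exprS_increment R k m%:R (ler0n _ _).
rewrite big_ord_recr /= -[m.+1%:R]natr1 !mulrDr; rewrite mulrDr in IH2.
move: (k.+1%:R * _) (k.+1%:R * _) (k.+1%:R * _) (_ ^+ k.+1) (_ ^+ k.+1)
  IH1 IH2 H1 H2 => s p q u v IH1 IH2 H1 H2.
by split; lra.
Qed.

Lemma mean_rank_bounds (R : realType) (k m : nat) : (0 < m)%N ->
  m%:R / (k.+1)%:R - 1 <= mean_rank R k m <= m%:R / (k.+1)%:R.
Proof.
move=> m0; have m0' : 0 < m%:R :> R by rewrite ltr0n.
have [H1 H2] := sum_powers R k m.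
have -> : mean_rank R k m = (\sum_(j < m) j%:R ^+ k) / m%:R ^+ k.
  by rewrite mulr_suml; apply: eq_bigr => j _; rewrite expr_div_n.
set S := \sum_(j < m) _ in H1 H2 *.
have mk : 0 < m%:R ^+ k :> R by rewrite exprn_gt0.
have k1 : 0 < k.+1%:R :> R by rewrite ltr0n.
rewrite exprS in H1 H2; apply/andP; split.
  rewrite ler_pdivlMr // mulrBl mul1r lerBlDr mulrAC ler_pdivrMr //.
  by rewrite [leRHS]mulrC.
by rewrite ler_pdivrMr // mulrAC ler_pdivlMr // mulrC.
Qed.

(** Writing a = 1 / (2 (k + 1)), adding the round on n + 1 cards changes the
    difference by mean_rank - (n + 1) / (k + 1) + a, which has absolute value at
    most 1. *)
Lemma mean_total_asymptotics (R : realType) (k n : nat) :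
  `|mean_total R k n - 1 / (2 * (k%:R + 1)) * n%:R ^+ 2| <= n%:R.
Proof.
rewrite natr1; set a := 1 / _.
have k1 : 1 <= k.+1%:R :> R by rewrite ler1n.
have a0 : 0 <= a by rewrite divr_ge0 // mulr_ge0.
have a1 : a <= 1 by rewrite ler_pdivrMr; lra.
have inva : k.+1%:R^-1 = 2 * a :> R by rewrite /a; field; lra.
elim: n => [|n]; first by rewrite /mean_total big_ord0 expr0n mulr0 subrr normr0.
have /andP[] := @mean_rank_bounds R k n.+1 isT.
rewrite mean_totalS inva !ler_norml -natr1 => H1 H2 /andP[H3 H4].
by apply/andP; split; lra.
Qed.

(** * Chebyshev's inequality for the inversions *)

(** A sequence of rounds determines at most one permutation, so exchanging the
    sums counts each sequence at most once. *)
Lemma kCM_prob_le (R : realType) (n k : nat) (B : pred nat) :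
  kCM_prob R k (fun s : {perm 'I_n} => B (inversions s)) <=
  \sum_(w : n.-tuple (round n k))
     rounds_prob R [set: 'I_n]%SET w * (B (total_rank [set: 'I_n]%SET w))%:R.
Proof.
rewrite /kCM_prob /kCM_mass (exchange_big_dep xpredT) //=.
apply: ler_sum => w _; have p0 := rounds_prob_ge0 R [set: 'I_n]%SET w.
case: (pickP (fun s : {perm 'I_n} => B (inversions s) &&
   [forall t, card_min (tnth w t) == s t :> nat])) => [s|no_s]; last first.
  by rewrite big_pred0 // mulr_ge0.
move=> /andP[Bs /forallP ws]; have {}ws t : card_min (tnth w t) = s t by apply/eqP.
rewrite (big_pred1 s) => [|s'].
  by rewrite -(inversions_total_rank ws) Bs mulr1.
apply/andP/eqP => [[_ /forallP ws']|->].
  by apply/permP => t; apply: val_inj; rewrite /= -ws; apply/esym/eqP.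
by split=> //; apply/forallP => t; rewrite ws.
Qed.

(** The second moment about a n^2 is the variance plus the squared bias, that is
    at most n^3 + n^2 <= 2 n^3. *)
Lemma kCM_prob_deviation (R : realType) (k n : nat) (eps : R) :
  (0 < k)%N -> 0 < eps ->
  kCM_prob R k (fun s : {perm 'I_n.+1} =>
     eps < `|(inversions s)%:R / n.+1%:R ^+ 2 - 1 / (2 * (k%:R + 1))|)
  <= 2 / eps ^+ 2 * n.+1%:R^-1.
Proof.
move=> k0 eps0; set a := 1 / _; set N : R := n.+1%:R.
have N1 : 1 <= N by rewrite ler1n.
apply: le_trans (kCM_prob_le _ _ _ (fun i => eps < `|i%:R / N ^+ 2 - a|)) _.
set D := [set: _]%SET; have Dn : #|D| = n.+1 by rewrite cardsT card_ord.
have dev := mean_total_asymptotics R k n.+1; rewrite -/a -/N in dev.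
have c0 : 0 < eps ^+ 2 * N ^+ 4 by rewrite mulr_gt0 ?exprn_gt0 //; lra.
set b := mean_total R k n.+1 - a * N ^+ 2 in dev.
(* Markov's inequality for the squared deviation *)
apply: (@le_trans _ _ ((\sum_(w : n.+1.-tuple (round n.+1 k))
  rounds_prob R D w * ((total_rank D w)%:R - a * N ^+ 2) ^+ 2)
   / (eps ^+ 2 * N ^+ 4))).
  rewrite mulr_suml; apply: ler_sum => w _; rewrite -mulrA.
  apply: ler_wpM2l; first exact: rounds_prob_ge0.
  case: ltP => /= [big|_]; last by rewrite divr_ge0 ?sqr_ge0 // ltW.
  rewrite ler_pdivlMr // mul1r.
  set T := (total_rank D w)%:R in big *.
  have -> : T - a * N ^+ 2 = (T / N ^+ 2 - a) * N ^+ 2 by field; lra.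
  rewrite exprMn -exprM ler_wpM2r ?exprn_ge0 //.
  by rewrite -[leRHS]real_normK ?num_real // lerXn2r ?nnegrE ?normr_ge0 ?ltW.
rewrite ler_pdivrMr //.
have -> : 2 / eps ^+ 2 * N^-1 * (eps ^+ 2 * N ^+ 4) = 2 * N ^+ 3 by field; lra.
apply: (@le_trans _ _ (N ^+ 3 + b ^+ 2)); last first.
  have : b ^+ 2 <= N ^+ 2.
    by rewrite -[leLHS]real_normK ?num_real // lerXn2r ?nnegrE ?normr_ge0 //; lra.
  nra.
apply: le_trans (lerD (variance_total_rank R k0 Dn) (lexx _)).
rewrite -[X in _ + X]mulr1 -[X in _ + _ * X](sum_rounds_prob R k0 Dn).
(* insert the vanishing cross term, then compare the summands *)
rewrite -[leRHS]addr0 -[X in _ <= _ + X](mulr0 (b *+ 2)).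
rewrite -[X in _ <= _ + _ * X](mean_total_rank R k0 Dn).
rewrite !mulr_sumr -!big_split /= le_eqVlt; apply/orP; left; apply/eqP.
by apply: eq_bigr => w _; rewrite /b; ring.
Qed.

Lemma kCM_prob_ge0 (R : realType) (k n : nat) (A : pred {perm 'I_n}) :
  0 <= kCM_prob R k A.
Proof.
by do 2 apply: sumr_ge0 => ? _; apply: rounds_prob_ge0.
Qed.

Theorem theorem1 (R : realType) (k : nat) (hk : (0 < k)%N) :
  let a : R := 1 / (2 * (k%:R + 1)) in
  forall eps : R, 0 < eps ->
    (fun n : nat =>
       kCM_prob R k
         (fun s : {perm 'I_n} =>
            eps < `| (inversions s)%:R / n%:R ^+ 2 - a |)) @ \oo --> (0 : R).
Proof.
move=> a eps eps0; rewrite -cvg_shiftS /=.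
apply: (@squeeze_cvgr _ _ _ _ (fun=> 0) (fun n => 2 / eps ^+ 2 * harmonic n)).
- by near=> n; rewrite kCM_prob_ge0 kCM_prob_deviation.
- exact: cvg_cst.
- rewrite -[X in _ --> X](mulr0 (2 / eps ^+ 2)).
  exact: cvgM (cvg_cst _) (@cvg_harmonic R).
Unshelve. all: by end_near.
Qed.
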